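(* Let $f\in C(\Omega)\cap L^\infty(\Omega)$ and $g\in C(\partial\Omega)$. There exist viscosity solutions $\underline u,\bar u\in C(\bar\Omega)$, both locally Lipschitz in $\Omega$, of $$-\Delta_\infty u=f\ \text{ in }\Omega,\qquad u=g\ \text{ on }\partial\Omega,$$ such that: whenever $w\in\mathrm{USC}(\bar\Omega)$ is a viscosity subsolution of $-\Delta_\infty w=f$ in $\Omega$ and $w\le g$ on $\partial\Omega$, we have $w\le\bar u$ in $\Omega$; and whenever $w\in\mathrm{LSC}(\bar\Omega)$ is a viscosity supersolution of $-\Delta_\infty w=f$ in $\Omega$ and $w\ge g$ on $\partial\Omega$, we have $w\ge\underline u$ in $\Omega$.
   Context: $\Omega\subseteq\mathbb{R}^n$ is a bounded, connected, open set. It is assumed that $\operatorname{diam}(\Omega):=\sup\{d(x,y):x,y\in\bar\Omega\}<\infty$, where $d(x,y)$ is the infimum of the lengths of Lipschitz paths in $\bar\Omega$ joining $x$ to $y$. $\mathrm{USC}(\bar\Omega)$ and $\mathrm{LSC}(\bar\Omega)$ are the sets of upper and lower semicontinuous real-valued functions on $\bar\Omega$. For a $C^2$ function $\varphi$ near $x$: if $D\varphi(x)\ne0$, $\Delta_\infty^+\varphi(x)=\Delta_\infty^-\varphi(x):=|D\varphi(x)|^{-2}\langle D^2\varphi(x)D\varphi(x),D\varphi(x)\rangle$; if $D\varphi(x)=0$, $\Delta_\infty^+\varphi(x):=\max_{|v|=1}\langle D^2\varphi(x)v,v\rangle$ and $\Delta_\infty^-\varphi(x):=\min_{|v|=1}\langle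 D^2\varphi(x)v,v\rangle$. An upper semicontinuous $u$ is a viscosity subsolution of $-\Delta_\infty u=f$ in $\Omega$ if, for every polynomial $\varphi$ of degree 2 (at most) and $x_0\in\Omega$ such that $u-\varphi$ has a strict local maximum at $x_0$, $-\Delta_\infty^+\varphi(x_0)\le f(x_0)$. A lower semicontinuous $u$ is a viscosity supersolution if, for every such $\varphi$ and $x_0\in\Omega$ such that $u-\varphi$ has a strict local minimum at $x_0$, $-\Delta_\infty^-\varphi(x_0)\ge f(x_0)$. A viscosity solution is both. (Equivalently, one may use all $\varphi\in C^2$ and non-strict extrema.) *)

(* Defs.v *)
From HB Require Import structures.
From mathcomp Require Import all_boot all_order all_algebra.
From mathcomp Require Import all_classical all_reals all_analysis.
Set Implicit Arguments.
Unset Strict Implicit.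
Unset Printing Implicit Defensive.
Import Order.TTheory GRing.Theory Num.Theory.
Import numFieldNormedType.Exports.
Local Open Scope classical_set_scope.
Local Open Scope ring_scope.

(* The library norm on row vectors is the maximum norm.  It is used below only
   where equivalent norms give the same notion (topology, boundedness, the
   Lipschitz property); lengths and unit vectors use [enorm]. *)
Definition dotv (R : realType) (n : nat) (u v : 'rV[R]_n) : R :=
  \sum_(i < n) u ord0 i * v ord0 i.

Definition enorm (R : realType) (n : nat) (v : 'rV[R]_n) : R :=
  Num.sqrt (dotv v v).

Definition bdry (T : topologicalType) (A : set T) : set T := closure A `\` A^°.

Definition lipschitz_path (R : realType) (n : nat) (S : set 'rV[R]_n)
    (x y : 'rV[R]_n) (gamma : R -> 'rV[R]_n) : Prop :=
  [/\ [lipschitz gamma t | t in `[0, 1]],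
      forall t, t \in `[0, 1] -> S (gamma t),
      gamma 0 = x & gamma 1 = y].

(* Vector-valued analogue of [variation]. *)
Definition polygon_length (R : realType) (n : nat) (gamma : R -> 'rV[R]_n)
    (s : seq R) : R :=
  \sum_(0 <= k < size s)
    enorm (gamma (nth 1 (0 :: s) k.+1) - gamma (nth 1 (0 :: s) k)).

Definition path_length (R : realType) (n : nat) (gamma : R -> 'rV[R]_n) :
    \bar R :=
  ereal_sup [set (polygon_length gamma s)%:E | s in itv_partition 0 1].

Definition path_dist (R : realType) (n : nat) (S : set 'rV[R]_n)
    (x y : 'rV[R]_n) : \bar R :=
  ereal_inf [set path_length gamma | gamma in lipschitz_path S x y].

Definition path_diam (R : realType) (n : nat) (Omega : set 'rV[R]_n) :
    \bar R :=
  ereal_sup [set path_dist (closure Omega) p.1 p.2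
            | p in closure Omega `*` closure Omega].

(* Real functions on A are represented by total functions whose values outside
   A are irrelevant: semicontinuity is that of the restriction to A. *)
Definition lsc_on (R : realType) (n : nat) (A : set 'rV[R]_n)
    (u : 'rV[R]_n -> R) : Prop :=
  @lower_semicontinuous (subspace A) R (fun x => (u x)%:E).

Definition usc_on (R : realType) (n : nat) (A : set 'rV[R]_n)
    (u : 'rV[R]_n -> R) : Prop :=
  lsc_on A (fun x => - u x).

Definition locally_lipschitz (R : realType) (n : nat) (A : set 'rV[R]_n)
    (u : 'rV[R]_n -> R) : Prop :=
  forall x, A x -> exists2 U, nbhs x U & [lipschitz u y | y in U `&` A].

Definition grad (R : realType) (n : nat) (phi : 'rV[R]_n -> R)
    (x : 'rV[R]_n) : 'rV[R]_n :=
  \row_(i < n) 'D_(delta_mx ord0 i) phi x.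

Definition hess (R : realType) (n : nat) (phi : 'rV[R]_n -> R)
    (x : 'rV[R]_n) : 'M[R]_n :=
  \matrix_(i < n, j < n)
    'D_(delta_mx ord0 i) (fun y => 'D_(delta_mx ord0 j) phi y) x.

Definition hess_form (R : realType) (n : nat) (phi : 'rV[R]_n -> R)
    (x v : 'rV[R]_n) : R :=
  dotv (v *m hess phi x) v.

(* For n > 0 the unit sphere is compact and nonempty, so that the supremum and
   the infimum below are attained. *)
Definition inf_lap_plus (R : realType) (n : nat) (phi : 'rV[R]_n -> R)
    (x : 'rV[R]_n) : R :=
  if grad phi x != 0 then
    (enorm (grad phi x) ^+ 2)^-1 * hess_form phi x (grad phi x)
  else sup [set hess_form phi x v | v in [set v | enorm v = 1]].

Definition inf_lap_minus (R : realType) (n : nat) (phi : 'rV[R]_n -> R)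
    (x : 'rV[R]_n) : R :=
  if grad phi x != 0 then
    (enorm (grad phi x) ^+ 2)^-1 * hess_form phi x (grad phi x)
  else inf [set hess_form phi x v | v in [set v | enorm v = 1]].

(* Polynomial of degree at most 2; A need not be symmetric. *)
Definition quadratic_poly (R : realType) (n : nat) (phi : 'rV[R]_n -> R) :
    Prop :=
  exists (c : R) (p : 'rV[R]_n) (A : 'M[R]_n),
    forall x, phi x = c + dotv p x + dotv (x *m A) x.

Definition strict_local_max (R : realType) (n : nat) (h : 'rV[R]_n -> R)
    (x0 : 'rV[R]_n) : Prop :=
  \forall x \near x0, x != x0 -> h x < h x0.

Definition strict_local_min (R : realType) (n : nat) (h : 'rV[R]_n -> R)
    (x0 : 'rV[R]_n) : Prop :=
  \forall x \near x0, x != x0 -> h x0 < h x.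

Definition visc_subsolution (R : realType) (n : nat) (Omega : set 'rV[R]_n)
    (f u : 'rV[R]_n -> R) : Prop :=
  usc_on Omega u /\
  forall (phi : 'rV[R]_n -> R) (x0 : 'rV[R]_n),
    quadratic_poly phi -> Omega x0 ->
    strict_local_max (fun x => u x - phi x) x0 ->
    - inf_lap_plus phi x0 <= f x0.

Definition visc_supersolution (R : realType) (n : nat) (Omega : set 'rV[R]_n)
    (f u : 'rV[R]_n -> R) : Prop :=
  lsc_on Omega u /\
  forall (phi : 'rV[R]_n -> R) (x0 : 'rV[R]_n),
    quadratic_poly phi -> Omega x0 ->
    strict_local_min (fun x => u x - phi x) x0 ->
    f x0 <= - inf_lap_minus phi x0.

Definition visc_solution (R : realType) (n : nat) (Omega : set 'rV[R]_n)
    (f u : 'rV[R]_n -> R) : Prop :=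
  visc_subsolution Omega f u /\ visc_supersolution Omega f u.

Definition dirichlet_solution (R : realType) (n : nat) (Omega : set 'rV[R]_n)
    (f g u : 'rV[R]_n -> R) : Prop :=
  [/\ {within closure Omega, continuous u},
      locally_lipschitz Omega u,
      visc_solution Omega f u &
      forall x, bdry Omega x -> u x = g x].

(* Main.v *)
Require Import Defs.
From mathcomp Require Import all_boot all_order all_algebra.
From mathcomp Require Import all_classical all_reals all_analysis.
From mathcomp Require Import ring lra.
Import Order.TTheory GRing.Theory Num.Theory.
Import numFieldNormedType.Exports.
Local Open Scope classical_set_scope.
Local Open Scope ring_scope.

(** The maximal solution is built by Perron's method: it is the pointwise
    supremum of all upper semicontinuous subsolutions lying below g on the
    boundary.  Maximality is then part of the construction, and what has to be
    proved is that this supremum is a continuous solution with boundary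
    values g.  There is no comparison principle for this equation, and
    solutions need not be unique, so the usual comparison of the two
    semicontinuous envelopes is not available.  Its role is played by explicit
    radial functions

      cone a b k z x = a + b |x - z| - (k / 2) |x - z|^2.

    Where the slope b - k |x - z| is positive, the gradient is radial and the
    second derivative in its direction is -k, so that a cone satisfies
    - Delta_infty = k.  When k exceeds sup |f|, cones are strict
    supersolutions away from their vertex: a subsolution cannot touch one from
    above, hence lies below it as soon as it does so on the boundary
    ([cone_comparison]).  Symmetrically, opposites of cones are subsolutions
    ([cone_subsolution]).  Everything follows from these two facts:

    - with a vertex outside Omega they give uniform bounds on the family;
    - with a vertex at a boundary point z and a large slope b they are barriers,
      which force the Perron function to tend to g z ([perron_bdry]);
    - with a vertex at an interior point y, on a small ball, they bound
      w x - w y by a multiple of |x - y| for every member w of the family that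
      is bounded below.  The maximum of w with one fixed member is again in the
      family, so the supremum itself is locally Lipschitz ([perron_cone]).

    Once the Perron function is known to be continuous, the remaining steps are
    the classical ones: a supremum of subsolutions is a subsolution
    ([visc_subsolution_sup]), and the largest subsolution is a supersolution,
    since otherwise it could be raised near a point where the supersolution
    test fails ([visc_supersolution_maximal]).

    The minimal solution is obtained by changing the signs of u, f and g, which
    exchanges subsolutions and supersolutions.

    Only the second-order expansion of a test function matters, so the
    definitions are first translated into statements on jets
    ([visc_subsolutionP]); the operator is then handled through [dir_ge], which
    treats zero and nonzero gradients alike. *)

Set Implicit Arguments.
Unset Strict Implicit.
Unset Printing Implicit Defensive.

(** * Euclidean vectors and quadratic polynomials *)

Section Euclid.
Variables (R : realType) (n : nat).
Implicit Types (u v w x y z : 'rV[R]_n) (a b c : R) (A B : 'M[R]_n).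

Lemma dotvC u v : dotv u v = dotv v u.
Proof. by apply: eq_bigr => i _; rewrite mulrC. Qed.

Lemma dotvDl u v w : dotv (u + v) w = dotv u w + dotv v w.
Proof. by rewrite -big_split; apply: eq_bigr => i _; rewrite mxE mulrDl. Qed.

Lemma dotvZl a u w : dotv (a *: u) w = a * dotv u w.
Proof. by rewrite mulr_sumr; apply: eq_bigr => i _; rewrite mxE mulrA. Qed.

Lemma dotvDr u v w : dotv w (u + v) = dotv w u + dotv w v.
Proof. by rewrite !(dotvC w) dotvDl. Qed.

Lemma dotvZr a u w : dotv w (a *: u) = a * dotv w u.
Proof. by rewrite !(dotvC w) dotvZl. Qed.

Lemma dotvNl u w : dotv (- u) w = - dotv u w.
Proof. by rewrite -scaleN1r dotvZl mulN1r. Qed.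

Lemma dotvNr u w : dotv w (- u) = - dotv w u.
Proof. by rewrite !(dotvC w) dotvNl. Qed.

Lemma dot0v w : dotv 0 w = 0.
Proof. by rewrite -(scale0r 0) dotvZl mul0r. Qed.

Lemma dotv0 w : dotv w 0 = 0.
Proof. by rewrite dotvC dot0v. Qed.

Definition dotvE := (dotvDl, dotvDr, dotvNl, dotvNr, dotvZl, dotvZr).

Lemma dotv_ge0 v : 0 <= dotv v v.
Proof. by apply: sumr_ge0 => i _; rewrite -expr2 sqr_ge0. Qed.

Lemma dotv_trmx u v A : dotv (u *m A) v = dotv u (v *m A^T).
Proof.
rewrite /dotv; under eq_bigr do rewrite mxE mulr_suml.
rewrite exchange_big; apply: eq_bigr => i _; rewrite mxE mulr_sumr.
by apply: eq_bigr => j _; rewrite mxE; ring.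
Qed.

Lemma enorm_ge0 v : 0 <= enorm v.
Proof. exact: sqrtr_ge0. Qed.

Lemma sqr_enorm v : enorm v ^+ 2 = dotv v v.
Proof. by rewrite sqr_sqrtr // dotv_ge0. Qed.

Lemma entry_le_enorm v i : `|v ord0 i| <= enorm v.
Proof.
rewrite -(@ler_pXn2r _ 2) ?nnegrE ?enorm_ge0 // sqr_enorm real_normK ?num_real //.
rewrite /dotv (bigD1 i) //= -expr2 lerDl.
by apply: sumr_ge0 => j _; rewrite -expr2 sqr_ge0.
Qed.

Lemma norm_le_enorm v : `|v| <= enorm v.
Proof.
rewrite [leLHS]/Num.Def.normr /= mx_normrE; apply/bigmax_leP; split; first exact: enorm_ge0.
by move=> [i j] _ /=; rewrite (ord1 i) entry_le_enorm.
Qed.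

Lemma entry_le_norm v i : `|v ord0 i| <= `|v|.
Proof. by rewrite [leRHS]/Num.Def.normr /= mx_normrE; apply/bigmax_geP; right; exists (ord0, i). Qed.

Lemma enorm_le_norm v : enorm v <= n.+1%:R * `|v|.
Proof.
rewrite -(@ler_pXn2r _ 2) ?nnegrE ?enorm_ge0 ?mulr_ge0 // sqr_enorm.
apply: (@le_trans _ _ (\sum_(i < n) `|v| ^+ 2)).
  apply: ler_sum => i _; rewrite -expr2 -(real_normK (num_real (v _ _))).
  by rewrite lerXn2r ?nnegrE ?normr_ge0 ?entry_le_norm.
rewrite sumr_const card_ord exprMn -[leLHS]mulr_natl ler_wpM2r ?sqr_ge0 //.
by rewrite -natrX ler_nat -mulnn (leq_trans (leqnSn n)) // leq_pmulr.
Qed.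

Lemma enorm0 : enorm (0 : 'rV[R]_n) = 0.
Proof. by rewrite /enorm dot0v sqrtr0. Qed.

Lemma enorm_eq0 v : (enorm v == 0) = (v == 0).
Proof.
apply/eqP/eqP => [v0|->]; last exact: enorm0.
by apply/eqP; rewrite -normr_le0 -v0 norm_le_enorm.
Qed.

Lemma enorm_gt0 v : (0 < enorm v) = (v != 0).
Proof. by rewrite lt_def enorm_ge0 andbT enorm_eq0. Qed.

Lemma enormZ a v : enorm (a *: v) = `|a| * enorm v.
Proof. by rewrite /enorm dotvZl dotvZr mulrA -expr2 sqrtrM ?sqr_ge0 // sqrtr_sqr. Qed.

Lemma enormN v : enorm (- v) = enorm v.
Proof. by rewrite -scaleN1r enormZ normrN1 mul1r. Qed.

Lemma enormB u v : enorm (u - v) = enorm (v - u).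
Proof. by rewrite -enormN opprB. Qed.

Lemma cauchy_schwarz u v : `|dotv u v| <= enorm u * enorm v.
Proof.
have [->|u0] := eqVneq u 0; first by rewrite dot0v enorm0 normr0 mul0r.
have su : 0 < enorm u by rewrite enorm_gt0.
rewrite -(@ler_pXn2r _ 2) ?nnegrE ?mulr_ge0 ?enorm_ge0 ?normr_ge0 //.
rewrite real_normK ?num_real // exprMn.
have := dotv_ge0 (enorm u ^+ 2 *: v - dotv u v *: u).
rewrite !dotvE (dotvC v u) -!sqr_enorm => h.
have {}h : 0 <= enorm u ^+ 2 * (enorm u ^+ 2 * enorm v ^+ 2 - dotv u v ^+ 2).
  by apply: le_trans h _; rewrite le_eqVlt; apply/orP; left; apply/eqP; ring.
by move: h; rewrite pmulr_rge0 ?exprn_gt0 // subr_ge0.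
Qed.

Lemma enormD u v : enorm (u + v) <= enorm u + enorm v.
Proof.
rewrite -(@ler_pXn2r _ 2) ?nnegrE ?addr_ge0 ?enorm_ge0 // sqr_enorm.
rewrite !dotvE (dotvC v u) sqrrD -!sqr_enorm.
have := le_trans (ler_norm _) (cauchy_schwarz u v); lra.
Qed.

Lemma sqr_enormD u v :
  enorm (u + v) ^+ 2 = enorm u ^+ 2 + 2 * dotv u v + enorm v ^+ 2.
Proof. by rewrite !sqr_enorm !dotvE (dotvC v u); ring. Qed.

Lemma enorm_lip u v : `|enorm u - enorm v| <= enorm (u - v).
Proof.
have h1 := enormD (u - v) v; have h2 := enormD (v - u) u.
move: h1 h2; rewrite !subrK (enormB v u) ler_norml => h1 h2; apply/andP; split; lra.
Qed.

(** All later arguments take place in Euclidean balls; this equivalence is the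
    only bridge to the topology, which is that of the maximum norm. *)
Lemma nbhs_enormP x (P : set 'rV[R]_n) :
  nbhs x P <-> exists2 r, 0 < r & forall y, enorm (y - x) < r -> P y.
Proof.
split=> [/nbhs_ballP[r /= r0 h]|[r r0 h]].
  exists r => // y yr; apply: h; rewrite -ball_normE /= -opprB normrN.
  exact: le_lt_trans (norm_le_enorm _) yr.
apply/nbhs_ballP; exists (r / n.+1%:R) => /=; first exact: divr_gt0.
move=> y; rewrite -ball_normE /= -opprB normrN => yr; apply: h.
by apply: le_lt_trans (enorm_le_norm _) _; rewrite -ltr_pdivlMl // mulrC.
Qed.

Definition qform A v := dotv (v *m A) v.

Lemma qformD A B v : qform (A + B) v = qform A v + qform B v.
Proof. by rewrite /qform mulmxDr dotvDl. Qed.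

Lemma qformN A v : qform (- A) v = - qform A v.
Proof. by rewrite /qform mulmxN dotvNl. Qed.

Lemma qformZ a A v : qform (a *: A) v = a * qform A v.
Proof. by rewrite /qform -scalemxAr dotvZl. Qed.

Lemma qform_scalar a v : qform a%:M v = a * enorm v ^+ 2.
Proof. by rewrite /qform mul_mx_scalar dotvZl sqr_enorm. Qed.

Lemma qformZv A a v : qform A (a *: v) = a ^+ 2 * qform A v.
Proof. by rewrite /qform -scalemxAl dotvZl dotvZr; ring. Qed.

Lemma qform0v A : qform A 0 = 0.
Proof. by rewrite /qform dotv0. Qed.

(** The rank-one form that appears in the Hessian of |x - z|. *)
Lemma qform_outer y v : qform (y^T *m y) v = dotv y v ^+ 2.
Proof.
rewrite /qform mulmxA; suff -> : v *m y^T = (dotv y v)%:M.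
  by rewrite mul_scalar_mx dotvZl expr2.
apply/matrixP => i j; rewrite !ord1 !mxE eqxx mulr1n.
by apply: eq_bigr => k _; rewrite !mxE mulrC.
Qed.

Lemma qform_bound A : exists2 C, 0 <= C & forall v, `|qform A v| <= C * enorm v ^+ 2.
Proof.
exists (\sum_(i < n) \sum_(j < n) `|A j i|).
  by apply: sumr_ge0 => i _; apply: sumr_ge0.
move=> v; rewrite mulr_suml; apply: le_trans (ler_norm_sum _ _ _) _.
apply: ler_sum => i _; rewrite mxE !mulr_suml.
apply: le_trans (ler_norm_sum _ _ _) _; apply: ler_sum => j _.
rewrite !normrM -mulrA mulrCA ler_wpM2l // expr2.
by rewrite ler_pM ?entry_le_enorm.
Qed.

(** The square of the left-hand side is the quadratic form of A A^T. *)
Lemma mulmx_bound A : exists2 C, 0 <= C & forall v, enorm (v *m A) <= C * enorm v.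
Proof.
have [C C0 h] := qform_bound (A *m A^T).
exists (Num.sqrt C); first exact: sqrtr_ge0.
move=> v; rewrite -(@ler_pXn2r _ 2) ?nnegrE ?mulr_ge0 ?sqrtr_ge0 ?enorm_ge0 //.
rewrite sqr_enorm exprMn sqr_sqrtr // dotv_trmx dotvC -mulmxA.
exact: le_trans (ler_norm _) (h v).
Qed.

(** A need not be symmetric: the Hessian of this polynomial is A + A^T. *)
Definition quad c (p : 'rV[R]_n) A x0 x := c + dotv p (x - x0) + qform A (x - x0).

Lemma quad_recenter c p A x0 y0 :
  quad c p A x0 =
  quad (quad c p A x0 y0) (p + (y0 - x0) *m (A + A^T)) A y0.
Proof.
apply/funext => x; rewrite /quad /qform.
have -> : x - x0 = (x - y0) + (y0 - x0) by rewrite addrA subrK.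
move: (x - y0) (y0 - x0) => h k.
rewrite !(dotvE, mulmxDl, mulmxDr) (dotvC (k *m A^T)) -dotv_trmx; ring.
Qed.

Lemma quad_center c p A x0 : quad c p A x0 x0 = c.
Proof. by rewrite /quad subrr dotv0 qform0v !addr0. Qed.

Lemma quad_near c p A x0 e : 0 < e ->
  exists2 r, 0 < r & forall x, enorm (x - x0) < r -> `|quad c p A x0 x - c| < e.
Proof.
move=> e0; have [C C0 hC] := qform_bound A.
have K0 : 0 < enorm p + C + 1 by have := enorm_ge0 p; lra.
exists (Num.min 1 (e / (enorm p + C + 1))); first by rewrite lt_min ltr01 divr_gt0.
move=> x; rewrite lt_min ltr_pdivlMr // => /andP[x1 xe].
have s0 := enorm_ge0 (x - x0).
apply: le_lt_trans xe.
have -> : quad c p A x0 x - c = dotv p (x - x0) + qform A (x - x0).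
  by rewrite /quad; ring.
apply: le_trans (ler_normD _ _) _.
have h1 := cauchy_schwarz p (x - x0); have h2 := hC (x - x0).
have : C * enorm (x - x0) ^+ 2 <= C * enorm (x - x0).
  by rewrite ler_wpM2l // expr2 ler_piMr // ltW.
lra.
Qed.

End Euclid.

(** * Second-order jets and the infinity Laplacian *)

Section Jets.
Variables (R : realType) (n : nat).
Implicit Types (u v w x y z p : 'rV[R]_n) (a b c m : R) (A B : 'M[R]_n).

(** It suffices to differentiate at the centre, since a quadratic polynomial
    can be recentred anywhere; this also yields the second derivatives, a first
    derivative being a quadratic polynomial as well. *)
Lemma derive_quad c p A x0 v : 'D_v (quad c p A x0) x0 = dotv p v.
Proof.
rewrite /derive; apply: cvg_lim => //.
apply: (@cvg_trans _ ((fun h => dotv p v + h * qform A v) @ 0^')).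
  apply: near_eq_cvg; near=> h.
  have h0 : h != 0 by near: h; exact: nbhs_dnbhs_neq.
  rewrite /= quad_center /quad addrK qformZv dotvZr /GRing.scale /=.
  by field.
suff : dotv p v + h * qform A v @[h --> 0^'] --> dotv p v + 0 * qform A v.
  by rewrite mul0r addr0.
apply: cvgD; first exact: cvg_cst.
apply: cvgM; last exact: cvg_cst.
exact: (@cvg_within _ (nbhs (0 : R)) _).
Unshelve. all: by end_near. Qed.

Lemma dotv_delta w i : dotv w (delta_mx ord0 i) = w ord0 i.
Proof.
rewrite /dotv (bigD1 i) //= mxE !eqxx mulr1 big1 ?addr0 // => j ji.
by rewrite mxE eqxx (negbTE ji) mulr0.
Qed.

Lemma grad_quad c p A x0 : grad (quad c p A x0) x0 = p.
Proof. by apply/rowP => i; rewrite mxE derive_quad dotv_delta. Qed.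

Lemma hess_quad c p A x0 : hess (quad c p A x0) x0 = A + A^T.
Proof.
apply/matrixP => i j; rewrite [LHS]mxE; set e := delta_mx ord0 j.
have -> : (fun y => 'D_e (quad c p A x0) y) =
    quad (dotv p e) (e *m (A + A^T)^T) 0 x0.
  apply/funext => y; rewrite (quad_recenter c p A x0 y) derive_quad.
  rewrite /quad dotvDl dotv_trmx dotvC (dotvC (y - x0)) (dotvC e).
  by rewrite /qform mulmx0 dot0v addr0.
by rewrite derive_quad dotv_delta -rowE !mxE.
Qed.

Lemma hess_form_quad c p A x0 v :
  hess_form (quad c p A x0) x0 v = 2 * qform A v.
Proof.
rewrite /hess_form hess_quad mulmxDr dotvDl [X in _ + X]dotv_trmx trmxK.
by rewrite [X in _ + X]dotvC -/(qform A v); ring.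
Qed.

Lemma quadratic_polyP (phi : 'rV[R]_n -> R) x0 :
  quadratic_poly phi <-> exists c p A, phi = quad c p A x0.
Proof.
have E c p A x : quad c p A 0 x = c + dotv p x + dotv (x *m A) x.
  by rewrite /quad subr0.
split=> [[c [p [A h]]]|[c [p [A ->]]]].
  have -> : phi = quad c p A 0 by apply/funext => x; rewrite h E.
  by rewrite (quad_recenter c p A 0 x0); do 3 eexists.
by rewrite (quad_recenter c p A x0 0); do 3 eexists; move=> x; exact: E.
Qed.

Lemma oppr_quad c p A x0 x : - quad c p A x0 x = quad (- c) (- p) (- A) x0 x.
Proof. by rewrite /quad qformN dotvNl; ring. Qed.

(** For the jet (p, A), whose Hessian form is 2 qform A, this says that
    m <= Delta_infty^+.  A unit vector v with p = |p| v is p / |p| when p is not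
    zero and is arbitrary when p = 0, so the two cases of the operator merge.
    The slack e dispenses with attaining the supremum over the sphere. *)
Definition dir_ge p A m := forall e, 0 < e ->
  exists v, [/\ enorm v = 1, p = enorm p *: v & m - e < 2 * qform A v].

Lemma direction p : p != 0 ->
  enorm ((enorm p)^-1 *: p) = 1 /\ p = enorm p *: ((enorm p)^-1 *: p).
Proof.
rewrite -enorm_gt0 => p0; split; last by rewrite scalerA divff ?scale1r // gt_eqF.
by rewrite enormZ ger0_norm ?invr_ge0 ?ltW // mulVf // gt_eqF.
Qed.

Lemma directionE p v : p != 0 -> p = enorm p *: v -> v = (enorm p)^-1 *: p.
Proof.
by rewrite -enorm_gt0 => p0 {2}->; rewrite scalerA mulVf ?scale1r // gt_eqF.
Qed.

Lemma exists_unit : (0 < n)%N -> exists v : 'rV[R]_n, enorm v = 1.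
Proof.
move=> n0; exists (delta_mx ord0 (Ordinal n0)).
by rewrite /enorm dotv_delta mxE !eqxx sqrtr1.
Qed.

Lemma inf_lap_plus_quadP (n0 : (0 < n)%N) c p A x0 m :
  m <= inf_lap_plus (quad c p A x0) x0 <-> dir_ge p A m.
Proof.
rewrite /inf_lap_plus grad_quad; case: ifPn => [p0|/negPn/eqP ->].
  have [u1 pu] := direction p0; rewrite hess_form_quad.
  have -> : (enorm p ^+ 2)^-1 * (2 * qform A p) =
      2 * qform A ((enorm p)^-1 *: p) by rewrite qformZv exprVn; ring.
  split=> [h e e0|h].
    exists ((enorm p)^-1 *: p); split=> //; lra.
  apply/ler_addgt0Pr => e /h[v [_ /(directionE p0) ->]]; lra.
set S := (X in sup X).
have Sub : has_ubound S.
  have [C C0 hC] := qform_bound A; exists (2 * C) => _ [v /= v1 <-].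
  have := le_trans (ler_norm _) (hC v).
  by rewrite hess_form_quad v1 expr1n mulr1 ler_pM2l.
have S0 : S !=set0.
  by have [v v1] := exists_unit n0; exists (hess_form (quad c 0 A x0) x0 v), v.
split=> [h e e0|h].
  have [_ [v v1 <-] hv] := sup_adherent e0 (conj S0 Sub).
  exists v; split; [by []|by rewrite enorm0 scale0r|].
  move: hv; rewrite hess_form_quad; lra.
apply/ler_addgt0Pr => e /h[v [v1 _ hv]].
have : 2 * qform A v <= sup S.
  by apply: ub_le_sup => //; exists v => //; rewrite hess_form_quad.
lra.
Qed.

(** Source of the duality between subsolutions and supersolutions. *)
Lemma inf_lap_minusE c p A x0 :
  inf_lap_minus (quad c p A x0) x0 =
  - inf_lap_plus (quad (- c) (- p) (- A) x0) x0.
Proof.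
rewrite /inf_lap_minus /inf_lap_plus !grad_quad oppr_eq0 !hess_form_quad.
rewrite qformN -[- p]scaleN1r qformZv enormZ normrN1 mul1r.
case: ifPn => _; first by ring.
rewrite /inf; congr (- sup _); apply/seteqP; split=> x /=.
  case=> _ [v v1 <-] <-; exists v => //.
  by rewrite !hess_form_quad qformN mulrN.
case=> v v1 <-; exists (2 * qform A v); last by rewrite hess_form_quad qformN mulrN.
by exists v => //; rewrite hess_form_quad.
Qed.

(** Semicontinuity of the operator in the gradient.  If p = 0 the hypothesis
    concerns all unit vectors, hence those attached to any q.  If p is not zero,
    the conclusion amounts to positivity at q of the form of 2 A - m I, which is
    positive at p and continuous. *)
Lemma dir_open p A m e : 0 < e ->
  (forall v, enorm v = 1 -> p = enorm p *: v -> m + e <= 2 * qform A v) ->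
  exists2 r, 0 < r & forall q, enorm (q - p) < r ->
    forall v, enorm v = 1 -> q = enorm q *: v -> m < 2 * qform A v.
Proof.
move=> e0 h; have [p0|p0] := eqVneq p 0.
  exists 1 => // q _ v v1 _; apply: lt_le_trans (h v v1 _); first by lra.
  by rewrite p0 enorm0 scale0r.
have [u1 pu] := direction p0.
(* The form of N at t *: v is t ^ 2 times 2 * qform A v - m for a unit vector v. *)
pose N := 2 *: A - m%:M.
have NE v : qform N v = 2 * qform A v - m * enorm v ^+ 2.
  by rewrite qformD qformN qformZ qform_scalar.
have pN : 0 < qform N p.
  rewrite pu qformZv mulr_gt0 ?exprn_gt0 ?enorm_gt0 // NE u1.
  have := h _ u1 pu; lra.
have [r r0 hr] := quad_near (qform N p) (p *m (N + N^T)) N p pN.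
exists r => // q /hr.
have -> : quad (qform N p) (p *m (N + N^T)) N p q = qform N q.
  have := quad_recenter 0 0 N 0 p => /(congr1 (fun f => f q)).
  by rewrite /quad !subr0 !dot0v !add0r => ->.
move=> hq v v1 qv.
have : 0 < qform N q by move: hq; rewrite ltr_norml; lra.
rewrite qv qformZv NE v1; have [->|q0] := eqVneq (enorm q) 0.
  by rewrite expr0n mul0r ltxx.
by rewrite pmulr_rgt0 ?exprn_even_gt0 //; lra.
Qed.

(** Second-order necessary conditions at a local minimum. *)
Lemma quad_ge0 p A x0 :
  (\forall x \near x0, 0 <= quad 0 p A x0 x) -> p = 0 /\ forall v, 0 <= qform A v.
Proof.
case/nbhs_enormP => r r0 h.
have key v t : 0 < t -> t * enorm v < r -> 0 <= dotv p v + t * qform A v.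
  move=> t0 tr; have := h (t *: v + x0).
  rewrite addrK enormZ gtr0_norm // => /(_ tr).
  rewrite /quad addrK add0r dotvZr qformZv expr2 -mulrA -mulrDr.
  by rewrite pmulr_rge0.
have small v e : 0 < e -> exists2 t, 0 < t < e & t * enorm v < r.
  move=> e0; have v0 := enorm_ge0 v; pose t := Num.min (e / 2) (r / (enorm v + 1)).
  have t0 : 0 < t by rewrite lt_min !divr_gt0 //; lra.
  exists t; first by rewrite t0 /= gt_min; apply/orP; left; lra.
  have : t <= r / (enorm v + 1) by rewrite ge_min lexx orbT.
  rewrite ler_pdivlMr; last by lra.
  move=> tr; apply: lt_le_trans tr; rewrite ltr_pM2l //; lra.
have dp v : 0 <= dotv p v.
  apply/ler_addgt0Pr => e e0; have [C C0 hC] := qform_bound A.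
  pose K := `|qform A v| + 1.
  have K0 : 0 < K by have := normr_ge0 (qform A v); rewrite /K; lra.
  (* The linear term must be nonnegative up to t K, with t as small as wanted. *)
  have [t /andP[t0 te] tr] := small v (e / K) (divr_gt0 e0 K0).
  have := key v t t0 tr; move: te; rewrite ltr_pdivlMr //.
  have : t * qform A v <= t * K.
    by rewrite ler_pM2l // /K (le_trans (ler_norm _)) // lerDl.
  lra.
have p0 : p = 0.
  apply/eqP; rewrite -enorm_eq0 -[_ == 0](@expf_eq0 _ _ 2) sqr_enorm.
  by have := dp (- p); rewrite dotvNr eq_le dotv_ge0 andbT; lra.
split=> // v; have [t /andP[t0 _] tr] := small v 1 ltr01.
by have := key v t t0 tr; rewrite p0 dot0v add0r pmulr_rge0.
Qed.

End Jets.

(** * Semicontinuity in the Euclidean metric *)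

Section Semicontinuity.
Variables (R : realType) (n : nat).
Implicit Types (u w f phi : 'rV[R]_n -> R) (x y z : 'rV[R]_n) (A B K : set 'rV[R]_n).

Lemma nbhs_subspaceE A x : A x -> @nbhs _ (subspace A) x = within A (nbhs x).
Proof. by case: (nbhs_subspaceP A x). Qed.

Lemma usc_onP A u : usc_on A u <-> forall x, A x -> forall a, u x < a ->
  exists2 r, 0 < r & forall y, A y -> enorm (y - x) < r -> u y < a.
Proof.
split=> [h x Ax a uxa|h x a].
  have nE := nbhs_subspaceE Ax; have [|V] := h x (- a); first by rewrite lte_fin ltrN2.
  rewrite nE => /nbhs_enormP[r r0 hr] hV.
  exists r => // y Ay yr; have := hV y (hr y yr Ay).
  by rewrite lte_fin ltrN2.
rewrite lte_fin => uxa; have [Ax|nAx] := pselect (A x); last first.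
  have nE : @nbhs _ (subspace A) x = globally [set x].
    by case: (nbhs_subspaceP A x).
  exists [set x]; first by rewrite nE.
  by move=> y ->.
have [|r r0 hr] := h x Ax (- a); first by rewrite -ltrN2 opprK.
exists [set y | A y /\ enorm (y - x) < r] => [|y [Ay yr]].
  rewrite (nbhs_subspaceE Ax); apply/nbhs_enormP.
  by exists r => // y yr Ay; split.
by rewrite lte_fin -ltrN2 opprK; exact: hr.
Qed.

Lemma continuous_onP A f : {within A, continuous f} <->
  forall x, A x -> forall e, 0 < e ->
  exists2 r, 0 < r & forall y, A y -> enorm (y - x) < r -> `|f y - f x| < e.
Proof.
rewrite subspace_continuousP; split=> h x Ax.
  move=> e e0; have /cvgrPdist_lt /(_ e e0) /nbhs_enormP[r r0 hr] := h x Ax.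
  by exists r => // y Ay yr; rewrite distrC; apply: hr.
apply/cvgrPdist_lt => e e0; apply/nbhs_enormP.
have [r r0 hr] := h x Ax e e0; exists r => // y yr Ay.
by rewrite distrC; exact: hr.
Qed.

Lemma continuous_enormP f : continuous f <-> forall x e, 0 < e ->
  exists2 r, 0 < r & forall y, enorm (y - x) < r -> `|f y - f x| < e.
Proof.
split=> h x; last first.
  have near_f e : 0 < e -> nbhs x (fun y => `|f x - f y| < e).
    move=> e0; have [r r0 hr] := h x e e0.
    by apply/nbhs_enormP; exists r => // y /hr; rewrite distrC.
  exact: (proj2 (@cvgrPdist_lt _ _ _ (nbhs x) (nbhs_filter x) f (f x)) near_f).
move=> e e0; have /cvgrPdist_lt /(_ e e0) /nbhs_enormP[r r0 hr] := h x.
by exists r => // y /hr; rewrite distrC.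
Qed.

Lemma quad_continuous c (p : 'rV[R]_n) M x0 : continuous (quad c p M x0).
Proof.
apply/continuous_enormP => x e e0.
by rewrite (quad_recenter c p M x0 x) quad_center; exact: quad_near.
Qed.

Lemma continuous_enorm z : continuous (fun x => enorm (x - z)).
Proof.
apply/continuous_enormP => x e e0; exists e => // y; apply: le_lt_trans.
by have := enorm_lip (y - z) (x - z); rewrite opprB addrA subrK.
Qed.

Lemma usc_on_continuous A u : {within A, continuous u} -> usc_on A u.
Proof.
move=> /continuous_onP h; apply/usc_onP => x Ax a uxa.
have [|r r0 hr] := h x Ax (a - u x); first by rewrite subr_gt0.
exists r => // y Ay /(hr y Ay) /(le_lt_trans (ler_norm _)); lra.
Qed.

Lemma usc_on_sub A B u : B `<=` A -> usc_on A u -> usc_on B u.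
Proof.
move=> BA /usc_onP h; apply/usc_onP => x /BA Ax a /(h x Ax)[r r0 hr].
by exists r => // y /BA; exact: hr.
Qed.

Lemma usc_onB A u phi : usc_on A u -> continuous phi ->
  usc_on A (fun x => u x - phi x).
Proof.
move=> /usc_onP hu /continuous_enormP hphi; apply/usc_onP => x Ax a ua.
pose e := (a - (u x - phi x)) / 2; have e0 : 0 < e by rewrite divr_gt0 ?subr_gt0.
have [|r r0 hr] := hu x Ax (u x + e); first by rewrite ltrDl.
have [s s0 hs] := hphi x e e0.
exists (Num.min r s); first by rewrite lt_min r0.
move=> y Ay; rewrite lt_min => /andP[/(hr y Ay) + /hs].
rewrite ltr_norml /e; lra.
Qed.

Lemma usc_on_max A u w : usc_on A u -> usc_on A w ->
  usc_on A (fun x => Num.max (u x) (w x)).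
Proof.
move=> /usc_onP hu /usc_onP hw; apply/usc_onP => x Ax a; rewrite gt_max.
case/andP => /(hu x Ax)[r r0 hr] /(hw x Ax)[s s0 hs].
exists (Num.min r s); first by rewrite lt_min r0.
move=> y Ay; rewrite lt_min gt_max => /andP[/(hr y Ay) -> /(hs y Ay) ->] //.
Qed.

(** The sets where u is at least u y, for y in K, form a filter base; any
    cluster point is a maximum by upper semicontinuity. *)
Lemma usc_attains_max K u : compact K -> K !=set0 -> usc_on K u ->
  exists2 x, K x & forall y, K y -> u y <= u x.
Proof.
move=> cK [x0 Kx0] /usc_onP hu.
pose B y := [set x | K x /\ u y <= u x].
have FB : ProperFilter (filter_from K B).
  apply: filter_from_proper; last by move=> y Ky; exists y; split.
  apply: filter_from_filter; first by exists x0.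
  move=> y z Ky Kz; have [yz|zy] := leP (u y) (u z).
    by exists z => // x [Kx zx]; split; split => //; exact: le_trans zx.
  by exists y => // x [Kx yx]; split; split => //; exact: le_trans (ltW zy) yx.
have FK : filter_from K B K by exists x0 => // x [].
have [x [Kx clx]] := cK _ FB FK; exists x => // y Ky.
rewrite leNgt; apply/negP => xy; have [r r0 hr] := hu x Kx _ xy.
have Fy : filter_from K B (B y) by exists y.
have nx : nbhs x (fun z => enorm (z - x) < r) by apply/nbhs_enormP; exists r.
have [z [[Kz yz] zr]] := clx _ _ Fy nx.
by have := hr z Kz zr; rewrite ltNge yz.
Qed.

Definition eball x r : set 'rV[R]_n := [set y | enorm (y - x) <= r].

Lemma eball_closed x r : closed (eball x r).
Proof.
rewrite -[eball x r]setCK; apply: open_closedC; rewrite openE => y /= /negP.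
rewrite -ltNge => yr; apply/nbhs_enormP; exists (enorm (y - x) - r).
  by rewrite subr_gt0.
move=> z zy /= zr; have := enormD (z - x) (y - z).
have -> : z - x + (y - z) = y - x by rewrite addrC addrA subrK.
by move: zy zr; rewrite /eball /= (enormB z y); lra.
Qed.

Lemma eball_compact x r : compact (eball x r).
Proof.
apply: bounded_closed_compact (@eball_closed x r).
exists (r + enorm x); split; first exact: num_real.
move=> M hM y /= yr; apply: le_trans (norm_le_enorm y) _; apply: le_trans (ltW hM).
by apply: le_trans (lerD yr (lexx _)); rewrite -{1}(subrK x y) enormD.
Qed.

Lemma open_eball A x : open A -> A x -> exists2 r, 0 < r & eball x r `<=` A.
Proof.
rewrite openE => oA /oA /nbhs_enormP[r r0 hr]; exists (r / 2); first exact: divr_gt0.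
by move=> y; rewrite /eball /= => yr; apply: hr; lra.
Qed.

End Semicontinuity.

(** * Viscosity subsolutions through jets *)

Section Viscosity.
Variables (R : realType) (n : nat) (n0 : (0 < n)%N) (Omega : set 'rV[R]_n).
Implicit Types (u w f phi : 'rV[R]_n -> R) (x y z p : 'rV[R]_n) (A : 'M[R]_n).

(** Strict maxima may be replaced by contacts from above: adding (e / 4) |y - x|^2
    to the test polynomial makes the contact strict and costs e / 2 in the
    operator, which the slack of [dir_ge] absorbs. *)
Lemma visc_subsolutionP f u : visc_subsolution Omega f u <->
  usc_on Omega u /\ forall x p A, Omega x ->
    (\forall y \near x, u y <= quad (u x) p A x y) -> dir_ge p A (- f x).
Proof using n0.
split=> -[hu h]; split=> //.
  move=> x p A Ox jet e e0.
  have Q : quadratic_poly (quad (u x) p (A + (e / 4)%:M) x).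
    by apply/(quadratic_polyP _ x); do 3 eexists.
  have : - inf_lap_plus (quad (u x) p (A + (e / 4)%:M) x) x <= f x.
    apply: h => //; rewrite /strict_local_max quad_center subrr; near=> y.
    rewrite -subr_eq0 -enorm_eq0 => yx.
    have : u y <= quad (u x) p A x y by near: y.
    have : 0 < (e / 4) * enorm (y - x) ^+ 2.
      by rewrite mulr_gt0 ?divr_gt0 // exprn_gt0 // lt_def yx enorm_ge0.
    rewrite /quad qformD qform_scalar; lra.
  rewrite lerNl => /(inf_lap_plus_quadP n0) /(_ (e / 2) (divr_gt0 e0 _)) [//|].
  move=> v [v1 pv hv]; exists v; split=> //.
  by move: hv; rewrite qformD qform_scalar v1; lra.
move=> phi x /(quadratic_polyP _ x)[c [p [A ->]]] Ox.
rewrite /strict_local_max quad_center => smax.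
rewrite lerNl; apply/(inf_lap_plus_quadP n0); apply: h => //.
near=> y; have [->|yx] := eqVneq y x; first by rewrite quad_center.
have : y != x -> u y - quad c p A x y < u x - c by near: y.
by move=> /(_ yx); rewrite /quad; lra.
Unshelve. all: by end_near. Qed.

End Viscosity.

(** * Maxima, suprema and bumps of subsolutions *)

Section Perron.
Variables (R : realType) (n : nat) (n0 : (0 < n)%N) (Omega : set 'rV[R]_n).
Implicit Types (u w f phi g : 'rV[R]_n -> R) (x y z p : 'rV[R]_n) (A : 'M[R]_n).

Lemma visc_supersolutionE f u : visc_supersolution Omega f u <->
  visc_subsolution Omega (fun x => - f x) (fun x => - u x).
Proof.
have uE : (fun x => - - u x) = u by apply/funext => x; rewrite opprK.
rewrite /visc_subsolution /usc_on uE; split=> -[hu h]; split=> //.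
  move=> phi x qphi Ox smax; have := (quadratic_polyP phi x).1 qphi.
  case=> c [p [A phiE]]; move: qphi smax; rewrite {}phiE => _ smax.
  have := h (quad (- c) (- p) (- A) x) x.
  rewrite inf_lap_minusE !opprK lerN2; apply=> //.
    by apply/(quadratic_polyP _ x); do 3 eexists.
  apply: filterS smax => y + yx => /(_ yx).
  by rewrite -!oppr_quad; lra.
move=> phi x qphi Ox smin; have := (quadratic_polyP phi x).1 qphi.
case=> c [p [A phiE]]; move: qphi smin; rewrite {}phiE => _ smin.
rewrite inf_lap_minusE opprK -lerN2; apply: h => //.
  by apply/(quadratic_polyP _ x); do 3 eexists.
apply: filterS smin => y + yx => /(_ yx).
by rewrite -!oppr_quad; lra.
Qed.

Lemma visc_subsolution_max f u w :
  visc_subsolution Omega f u -> visc_subsolution Omega f w ->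
  visc_subsolution Omega f (fun x => Num.max (u x) (w x)).
Proof using n0.
move=> /(visc_subsolutionP n0)[uu hu] /(visc_subsolutionP n0)[uw hw].
apply/(visc_subsolutionP n0); split; first exact: usc_on_max.
move=> x p A Ox jet; have [uw_x|/ltW wu_x] := leP (u x) (w x).
  apply: hw => //; apply: filterS jet => y; rewrite (max_idPr uw_x).
  by apply: le_trans; rewrite le_max lexx orbT.
apply: hu => //; apply: filterS jet => y; rewrite (max_idPl wu_x).
by apply: le_trans; rewrite le_max lexx.
Qed.

Lemma not_dir_ge p A m : ~ dir_ge p A m -> exists2 e, 0 < e &
  forall v, enorm v = 1 -> p = enorm p *: v -> 2 * qform A v <= m - e.
Proof.
move=> h; apply: contrapT => h'; apply: h => e e0.
apply: contrapT => h''; apply: h'; exists e => // v v1 pv.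
by rewrite leNgt; apply/negP => ?; apply: h''; exists v.
Qed.

(** Stability under suprema.  If a jet of u at x0 violated the test by e, add
    (e / 8) |x - x0|^2 to make the contact quantitative, and take a member w of
    the family nearly equal to u at x0.  The maximum of w minus the perturbed
    polynomial is then attained close to x0; there w violates the test too, by
    [dir_open] and the continuity of f. *)
Lemma visc_subsolution_sup f u (F : set ('rV[R]_n -> R)) :
  open Omega -> {within Omega, continuous f} -> usc_on Omega u ->
  (forall w, F w -> visc_subsolution Omega f w) ->
  (forall w x, F w -> Omega x -> w x <= u x) ->
  (forall x e, Omega x -> 0 < e -> exists2 w, F w & u x - e < w x) ->
  visc_subsolution Omega f u.
Proof using n0.
move=> oO /continuous_onP cf uu hF Fle Fsup; apply/(visc_subsolutionP n0); split=> //.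
move=> x0 p A Ox jet; apply: contrapT => /not_dir_ge[e e0 hv].
pose A' := A + (e / 8)%:M.
have qA' v : qform A' v = qform A v + (e / 8) * enorm v ^+ 2.
  by rewrite /A' qformD qform_scalar.
have [|v v1 pv|rho rho0 hrho] := @dir_open _ _ p (- A') (f x0 + e / 4) (e / 2).
- by rewrite divr_gt0.
- by have := hv v v1 pv; rewrite qformN qA' v1; lra.
have [C C0 hC] := mulmx_bound (A' + A'^T).
have [r1 r10 hr1] := open_eball oO Ox.
have [r2 r20 hr2] := (nbhs_enormP _ _).1 jet.
have [r3 r30 hr3] := cf x0 Ox (e / 8) (divr_gt0 e0 (ltr0n _ 8)).
have C1 : 0 < C + 1 by rewrite ltr_wpDl.
pose s := Num.min (Num.min r1 (r2 / 2)) (Num.min (r3 / 2) (rho / (C + 1))).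
have s0 : 0 < s by rewrite !lt_min r10 !divr_gt0.
have [sr1 sr2 sr3 sr4] : [/\ s <= r1, s < r2, s < r3 & s <= rho / (C + 1)].
  have : s <= s by []. rewrite {2}/s !le_min => /andP[/andP[-> h2] /andP[h3 ->]].
  by split=> //; lra.
(* This precision keeps the maximum point within s / 2 of x0. *)
have [|w Fw uw] := Fsup x0 (e / 8 * (s ^+ 2 / 4)) Ox.
  by rewrite !mulr_gt0 ?invr_gt0 ?exprn_gt0.
pose phi := quad (u x0) p A' x0.
have KO : eball x0 s `<=` Omega.
  by move=> y ys; apply: hr1; apply: le_trans sr1.
have x0K : eball x0 s x0 by rewrite /eball /= subrr enorm0 ltW.
have [ww hw] := (visc_subsolutionP n0 _ _ _).1 (hF w Fw).
have [||y yK ymax] := @usc_attains_max _ _ (eball x0 s) (fun x => w x - phi x)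
    (@eball_compact _ _ x0 s).
- by exists x0.
- exact: usc_onB (usc_on_sub KO ww) (@quad_continuous _ _ _ _ _ _).
have Oy := KO y yK.
have ys : enorm (y - x0) < s.
  have := ymax x0 x0K; rewrite /phi quad_center /quad qA'.
  have := Fle w y Fw Oy; have := hr2 y (le_lt_trans yK sr2); rewrite /quad.
  move=> h1 h2 h3.
  have : e / 8 * enorm (y - x0) ^+ 2 < e / 8 * (s ^+ 2 / 4) by lra.
  rewrite ltr_pM2l ?divr_gt0 // => h4.
  rewrite -(@ltr_pXn2r _ 2) ?nnegrE ?enorm_ge0 ?(ltW s0) //.
  by have : 0 < s ^+ 2 by [rewrite exprn_gt0]; lra.
have phiE := quad_recenter (u x0) p A' x0 y; rewrite -/phi in phiE.
set q := p + _ in phiE.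
have : dir_ge q A' (- f y).
  apply: hw => //; apply/nbhs_enormP; exists (s - enorm (y - x0)).
    by rewrite subr_gt0.
  move=> z zy; have zK : eball x0 s z.
    have := enormD (z - y) (y - x0); rewrite addrA subrK /eball /=; lra.
  by have := ymax z zK; rewrite phiE quad_center /quad; lra.
move=> /(_ (e / 8)) [|v [v1 qv hqv]]; first by rewrite divr_gt0.
have : enorm (q - p) < rho.
  rewrite /q addrC addKr; apply: le_lt_trans (hC _) _.
  have : (C + 1) * enorm (y - x0) < rho.
    by rewrite mulrC -ltr_pdivlMr // (lt_le_trans ys).
  by have := enorm_ge0 (y - x0); lra.
move=> /hrho /(_ v v1 qv); rewrite qformN.
have := hr3 y Oy (lt_trans ys sr3); rewrite ltr_norml; lra.
Qed.

(** The bump argument.  If a jet of u from below at x0 violates the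
    supersolution test by e, lower the curvature of the polynomial by
    a multiple of e and raise it by a small eta.  The resulting phi is a classical
    subsolution near x0, exceeds u at x0 and is below u outside a smaller ball;
    so gluing in the maximum of u and phi gives an admissible subsolution larger
    than u at x0. *)
Lemma visc_supersolution_maximal f g u :
  open Omega -> {within Omega, continuous f} ->
  usc_on (closure Omega) u -> usc_on Omega (fun x => - u x) ->
  visc_subsolution Omega f u ->
  (forall x, bdry Omega x -> u x <= g x) ->
  (forall w, usc_on (closure Omega) w -> visc_subsolution Omega f w ->
     (forall x, bdry Omega x -> w x <= g x) -> forall x, Omega x -> w x <= u x) ->
  visc_supersolution Omega f u.
Proof using n0.
move=> oO /continuous_onP cf uu lu /(visc_subsolutionP n0)[_ hu] ug umax.
apply/visc_supersolutionE/(visc_subsolutionP n0); split=> //.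
move=> x0 p A Ox jet; rewrite opprK; apply: contrapT => /not_dir_ge[e e0 hv].
pose M := - (A + (e / 8)%:M).
have qM v : qform M v = - qform A v - (e / 8) * enorm v ^+ 2.
  by rewrite /M qformN qformD qform_scalar; ring.
have [|v v1 pv|rho rho0 hrho] := @dir_open _ _ (- p) M (- f x0 + e / 4) (e / 2).
- by rewrite divr_gt0.
- have := hv (- v); rewrite enormN v1 scalerN => /(_ erefl).
  rewrite -[- v]scaleN1r qformZv qM v1 -[p in p = _]opprK pv enormN => /(_ erefl).
  lra.
have [C C0 hC] := mulmx_bound (M + M^T).
have [r1 r10 hr1] := open_eball oO Ox.
have [r2 r20 hr2] := (nbhs_enormP _ _).1 jet.
have [r3 r30 hr3] := cf x0 Ox (e / 8) (divr_gt0 e0 (ltr0n _ 8)).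
have C1 : 0 < C + 1 by rewrite ltr_wpDl.
pose r := Num.min (Num.min r1 (r2 / 2)) (Num.min (r3 / 2) (rho / (C + 1))).
have r0 : 0 < r by rewrite !lt_min r10 !divr_gt0.
have [sr1 sr2 sr3 sr4] : [/\ r <= r1, r < r2, r < r3 & r <= rho / (C + 1)].
  have : r <= r by []. rewrite {2}/r !le_min => /andP[/andP[-> h2] /andP[h3 ->]].
  by split=> //; lra.
(* The lowered curvature creates exactly this gap at distance r / 2 from x0. *)
pose eta := e / 8 * (r ^+ 2 / 4).
have eta0 : 0 < eta by rewrite !mulr_gt0 ?exprn_gt0.
pose phi := quad (u x0 + eta) (- p) M x0.
have phi_small y : r / 2 <= enorm (y - x0) < r -> phi y <= u y.
  move=> /andP[h1 h2]; have := hr2 y (lt_trans h2 sr2).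
  rewrite /phi /quad dotvNl qM.
  have : eta <= e / 8 * enorm (y - x0) ^+ 2.
    rewrite ler_pM2l ?divr_gt0 //.
    have -> : r ^+ 2 / 4 = (r / 2) ^+ 2 by rewrite expr_div_n -natrX.
    by rewrite lerXn2r ?nnegrE ?enorm_ge0 //; lra.
  lra.
pose W y := if enorm (y - x0) < r then Num.max (u y) (phi y) else u y.
have uW y : u y <= W y by rewrite /W; case: ifP => // _; rewrite le_max lexx.
have Wu y : r / 2 <= enorm (y - x0) -> W y = u y.
  move=> h; rewrite /W; case: ifP => // h'.
  by apply/max_idPl; apply: phi_small; rewrite h.
have W_usc : usc_on (closure Omega) W.
  apply/usc_onP => x Kx a Wa; have [xr|xr] := ltP (enorm (x - x0)) r.
      have phi_usc : usc_on (closure Omega) phi.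
        exact/usc_on_continuous/continuous_subspaceT/quad_continuous.
      move: Wa; rewrite {1}/W xr => Wa.
      have [d d0 hd] := (usc_onP _ _).1 (usc_on_max uu phi_usc) x Kx a Wa.
      exists (Num.min d (r - enorm (x - x0))); first by rewrite lt_min d0 subr_gt0.
      move=> y Ky; rewrite lt_min => /andP[/(hd y Ky) h yd].
      have := enormD (y - x) (x - x0); rewrite addrA subrK => h'.
      by rewrite /W ifT //; lra.
  move: Wa; rewrite Wu => [ua|]; last by lra.
  have [d d0 hd] := (usc_onP _ _).1 uu x Kx a ua.
  exists (Num.min d (r / 2)); first by rewrite lt_min d0 divr_gt0.
  move=> y Ky; rewrite lt_min => /andP[/(hd y Ky) h yd].
  have := enormD (x - y) (y - x0); rewrite addrA subrK enormB => h'.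
  by rewrite Wu //; lra.
have Wmax : W x0 <= u x0.
  apply: umax => //.
  - apply/(visc_subsolutionP n0); split.
      exact: usc_on_sub (@subset_closure _ Omega) W_usc.
    move=> x q B Ox' jetW; have [Wx|Wx] := eqVneq (W x) (u x).
      apply: hu => //; apply: filterS jetW => y; rewrite Wx; exact: le_trans.
    have xr : enorm (x - x0) < r.
      by rewrite ltNge; apply/negP => xr; move: Wx; rewrite /W ltNge xr eqxx.
    have Wphi : W x = phi x.
      by move: Wx; rewrite /W xr; case: (leP (u x) (phi x)) => // _; rewrite eqxx.
    have phiE := quad_recenter (u x0 + eta) (- p) M x0 x; rewrite -/phi in phiE.
    set q' := - p + _ in phiE.
    have [|qq' BM] := @quad_ge0 _ _ (q - q') (B - M) x.
      have nx : nbhs x (fun y => enorm (y - x0) < r).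
        apply/nbhs_enormP; exists (r - enorm (x - x0)); first by rewrite subr_gt0.
        by move=> y yx; have := enormD (y - x) (x - x0); rewrite addrA subrK; lra.
      near=> y.
      have : W y <= quad (W x) q B x y by near: y.
      have yr : enorm (y - x0) < r by near: y.
      have : phi y <= W y by rewrite /W yr le_max lexx orbT.
      by rewrite Wphi {1}phiE /quad qformD qformN dotvDl dotvNl; lra.
    move: qq' => /subr0_eq qq' e' e'0.
    have [v v1 qv] : exists2 v, enorm v = 1 & q = enorm q *: v.
      have [->|qn0] := eqVneq q 0.
        by have [v v1] := exists_unit R n0; exists v; rewrite // enorm0 scale0r.
      by have [] := direction qn0; exists ((enorm q)^-1 *: q).
    exists v; split=> //.
    have : enorm (q - - p) < rho.
      rewrite qq' /q' addrC addKr; apply: le_lt_trans (hC _) _.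
      have : (C + 1) * enorm (x - x0) < rho.
        by rewrite mulrC -ltr_pdivlMr // (lt_le_trans xr).
      by have := enorm_ge0 (x - x0); lra.
    move=> /hrho /(_ v v1 qv).
    have := hr3 x Ox' (lt_trans xr sr3); rewrite ltr_norml.
    by have := BM v; rewrite qformD qformN; lra.
  - move=> x xb; rewrite /W ifN ?ug // -leNgt leNgt; apply/negP => xr.
    case: xb => _; apply; rewrite ((interior_id _).1 oO).
    by apply: hr1; apply: le_trans sr1; exact: ltW.
move: Wmax; rewrite /W subrr enorm0 r0 ge_max /phi quad_center; lra.
Unshelve. all: by end_near. Qed.

End Perron.

(** * Concave cones: comparison and barriers *)

Section Cones.
Variables (R : realType) (n : nat) (n0 : (0 < n)%N) (Omega : set 'rV[R]_n).
Implicit Types (u w f phi g : 'rV[R]_n -> R) (x y z p : 'rV[R]_n) (A : 'M[R]_n).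
Implicit Types (a b k : R) (K U : set 'rV[R]_n).

(** With d = |x + h| - |x|, the difference between |x + h| and the displayed
    second-order expansion is an exact rational expression in |x|, d and |h|,
    each term of which has order 3 or more because |d| <= |h|. *)
Lemma enorm_upper_jet x e : x != 0 -> 0 < e ->
  \forall h \near (0 : 'rV[R]_n), enorm (x + h) <=
    enorm x + dotv x h / enorm x + enorm h ^+ 2 / (2 * enorm x)
    - dotv x h ^+ 2 / (2 * enorm x ^+ 3) + e * enorm h ^+ 2.
Proof.
rewrite -enorm_gt0; set s := enorm x => s0 e0.
apply/nbhs_enormP; exists (Num.min s (s ^+ 2 * e / 2)).
  by rewrite lt_min s0 !mulr_gt0 ?exprn_gt0 ?invr_gt0.
move=> h; rewrite subr0 lt_min => /andP[hs he].
set d := enorm (x + h) - s; set t := enorm h.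
have t0 : 0 <= t := enorm_ge0 h.
have dt : `|d| <= t by have := enorm_lip (x + h) x; rewrite addrAC subrr add0r.
have sE : enorm (x + h) = s + d by rewrite /d; ring.
have xh : dotv x h = (2 * s * d + d ^+ 2 - t ^+ 2) / 2.
  have : (s + d) ^+ 2 = s ^+ 2 + 2 * dotv x h + t ^+ 2.
    by rewrite -sE; exact: sqr_enormD.
  by rewrite sqrrD => E; lra.
have cs : - (s * t) <= dotv x h.
  by have := cauchy_schwarz x h; rewrite -/s -/t ler_norml; lra.
have -> : enorm (x + h) = s + dotv x h / s + t ^+ 2 / (2 * s)
    - dotv x h ^+ 2 / (2 * s ^+ 3) +
    (4 * s * d ^+ 3 + d ^+ 4 - 4 * dotv x h * t ^+ 2 - t ^+ 4) / (8 * s ^+ 3).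
  by rewrite sE xh; field; rewrite gt_eqF.
rewrite lerD2l ler_pdivrMr; last by rewrite mulr_gt0 ?exprn_gt0.
(* Each cubic term of the remainder is at most s t^3 up to a factor, and t is
   at most s^2 e / 2. *)
have d3 : d ^+ 3 <= t ^+ 3.
  apply: le_trans (ler_norm _) _; rewrite normrX.
  by apply: lerXn2r; rewrite ?nnegrE.
have d4 : d ^+ 4 <= t ^+ 4.
  apply: le_trans (ler_norm _) _; rewrite normrX.
  by apply: lerXn2r; rewrite ?nnegrE.
have h1 : s * d ^+ 3 <= s * t ^+ 3 by rewrite ler_pM2l.
have h2 : - (s * t) * t ^+ 2 <= dotv x h * t ^+ 2 by rewrite ler_wpM2r ?sqr_ge0.
have h3 : s * t ^+ 2 * t <= s * t ^+ 2 * (s ^+ 2 * e / 2).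
  by apply: ler_wpM2l (ltW he); rewrite mulr_ge0 ?sqr_ge0 ?(ltW s0).
have h4 : 0 <= e * t ^+ 2 * s ^+ 3.
  by rewrite !mulr_ge0 ?sqr_ge0 ?exprn_ge0 // ltW.
clear -h1 h2 h3 h4 d4; lra.
Qed.

Definition cone a b k z x :=
  a + b * enorm (x - z) - k / 2 * enorm (x - z) ^+ 2.

Lemma cone_continuous a b k z : continuous (cone a b k z).
Proof.
move=> x; have ce := @continuous_enorm R n z x.
have ce2 : {for x, continuous (fun y => enorm (y - z) ^+ 2)} by exact: continuousM.
apply: (@continuousB _ _ _ (fun y => a + b * enorm (y - z))
  (fun y => k / 2 * enorm (y - z) ^+ 2)).
  apply: (@continuousD _ _ _ (cst a) (fun y => b * enorm (y - z))).
    exact: cst_continuous.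
  by apply: (@continuousM _ _ (cst b)) => //; exact: cst_continuous.
by apply: (@continuousM _ _ (cst (k / 2))) => //; exact: cst_continuous.
Qed.

(** The error d only lowers the equation satisfied by the cone to k - 2 d.
    The curvature matters only in the radial direction, that of the gradient. *)
Lemma cone_upper_jet a b k z x d : x != z -> 0 <= b -> 0 < d ->
  exists2 A, \forall y \near x, cone a b k z y <=
      quad (cone a b k z x) ((b / enorm (x - z) - k) *: (x - z)) A x y
    & qform A (x - z) = (d - k / 2) * enorm (x - z) ^+ 2.
Proof.
rewrite -subr_eq0 => y0 b0 d0; set y := x - z in y0 *; set s := enorm y.
have s0 : 0 < s by rewrite enorm_gt0.
exists ((b / (2 * s) - k / 2 + d)%:M - (b / (2 * s ^+ 3)) *: (y^T *m y)); last first.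
  rewrite qformD qformN qformZ qform_outer qform_scalar -sqr_enorm -/s.
  by field; rewrite gt_eqF.
have e0 : 0 < d / (b + 1) by rewrite divr_gt0 // ltr_wpDl.
have [r r0 hr] := (nbhs_enormP _ _).1 (enorm_upper_jet y0 e0).
apply/nbhs_enormP; exists r => // x' x'r; set h := x' - x in x'r.
have := hr h; rewrite subr0 => /(_ x'r).
rewrite /cone /quad -/h -/y -/s; have -> : x' - z = y + h.
  by rewrite /y /h [RHS]addrC addrA subrK.
move=> /(ler_wpM2l b0) jet.
have sqE : enorm (y + h) ^+ 2 = s ^+ 2 + 2 * dotv y h + enorm h ^+ 2.
  exact: sqr_enormD.
have bd : b * (d / (b + 1) * enorm h ^+ 2) <= d * enorm h ^+ 2.
  rewrite mulrA ler_wpM2r ?sqr_ge0 // mulrCA -[leRHS]mulr1 ler_pM2l //.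
  by rewrite ler_pdivrMr ?mul1r ?lerDl // ltr_wpDl.
rewrite qformD qformN qformZ qform_outer qform_scalar dotvZl sqE.
move: jet; rewrite !mulrDr mulrN.
lra.
Qed.

Lemma qform_unit A y m t : qform A y = m * enorm y ^+ 2 -> enorm (t *: y) = 1 ->
  qform A (t *: y) = m.
Proof.
move=> Ay ty; rewrite qformZv Ay mulrCA.
have -> : t ^+ 2 * enorm y ^+ 2 = enorm (t *: y) ^+ 2.
  by rewrite enormZ exprMn real_normK ?num_real.
by rewrite ty expr1n mulr1.
Qed.

(** At a positive interior maximum of w minus the cone, the jet of the cone
    would be a jet of w from above with nonzero radial gradient, whence
    k - 2 d <= f for all d > 0, against f < k. *)
Lemma cone_comparison f w K U a b k z :
  visc_subsolution Omega f w -> usc_on K w -> compact K ->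
  open U -> U `<=` K -> U `<=` Omega -> ~ U z -> 0 <= b ->
  (forall x, U x -> f x < k) ->
  (forall x, U x -> k * enorm (x - z) < b) ->
  (forall x, K x -> ~ U x -> w x <= cone a b k z x) ->
  forall x, K x -> w x <= cone a b k z x.
Proof using n0.
move=> /(visc_subsolutionP n0)[_ hw] uw cK oU UK UO Uz b0 fk kb bd x Kx.
have [||x1 Kx1 xmax] := @usc_attains_max _ _ K (fun y => w y - cone a b k z y) cK.
- by exists x.
- exact: usc_onB uw (@cone_continuous _ _ _ _).
suff : w x1 <= cone a b k z x1 by have := xmax x Kx; lra.
have [Ux1|] := pselect (U x1); last exact: bd.
have x1z : x1 != z by apply/eqP => E; rewrite E in Ux1.
have s0 : 0 < enorm (x1 - z) by rewrite enorm_gt0 subr_eq0.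
have fk0 : 0 < (k - f x1) / 4 by have := fk x1 Ux1; lra.
have [A jet Ay] := cone_upper_jet a k x1z b0 fk0.
set p := (_ - k) *: _ in jet.
have c0 : 0 < b / enorm (x1 - z) - k by rewrite subr_gt0 ltr_pdivlMr // kb.
have p0 : p != 0 by rewrite scaler_eq0 (gt_eqF c0) subr_eq0.
have /(_ _ fk0)[v [v1 pv]] : dir_ge p A (- f x1).
  apply: hw; first exact: UO.
  have UN : nbhs x1 U by apply: open_nbhs_nbhs.
  near=> y.
  have Uy : U y by near: y.
  have : cone a b k z y <= quad (cone a b k z x1) p A x1 y by near: y.
  by have := xmax y (UK y Uy); rewrite /quad; lra.
have vE : v = ((enorm p)^-1 * (b / enorm (x1 - z) - k)) *: (x1 - z).
  by rewrite (directionE p0 pv) /p scalerA.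
by rewrite vE (qform_unit Ay) -?vE //; have := fk x1 Ux1; lra.
Unshelve. all: by end_near. Qed.

(** A jet from above of - cone, added to the jet from above of the cone, has a
    minimum at the contact point; [quad_ge0] then identifies the gradients and
    compares the Hessians in the radial direction. *)
Lemma cone_subsolution f a b k z : ~ Omega z -> 0 <= b ->
  (forall x, Omega x -> - f x <= k) ->
  (forall x, Omega x -> k * enorm (x - z) < b) ->
  visc_subsolution Omega f (fun x => - cone a b k z x).
Proof using n0.
move=> Oz b0 fk kb; apply/(visc_subsolutionP n0); split.
  apply: usc_on_continuous; apply: continuous_subspaceT => x.
  exact: cvgN (@cone_continuous a b k z x).
move=> x q B Ox jet e e0.
have xz : x != z by apply/eqP => E; rewrite E in Ox.
have s0 : 0 < enorm (x - z) by rewrite enorm_gt0 subr_eq0.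
have [A jet' Ay] := cone_upper_jet a k xz b0 (divr_gt0 e0 (ltr0n _ 4)).
set p := (_ - k) *: _ in jet'.
have c0 : 0 < b / enorm (x - z) - k by rewrite subr_gt0 ltr_pdivlMr // kb.
have [|qp BA] := @quad_ge0 _ _ (q + p) (B + A) x.
  near=> y.
  have : cone a b k z y <= quad (cone a b k z x) p A x y by near: y.
  have : - cone a b k z y <= quad (- cone a b k z x) q B x y by near: y.
  by rewrite /quad qformD dotvDl; lra.
have {}qp : q = - p by apply/eqP; rewrite -addr_eq0; apply/eqP.
have q0 : q != 0.
  by rewrite qp oppr_eq0 scaler_eq0 (gt_eqF c0) subr_eq0.
have [v1 qv] := direction q0.
exists ((enorm q)^-1 *: q); split=> //.
have := BA ((enorm q)^-1 *: q); rewrite qformD.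
have vE : (enorm q)^-1 *: q =
    ((enorm q)^-1 * - (b / enorm (x - z) - k)) *: (x - z).
  by rewrite {2}qp -scaleNr scalerA.
rewrite [qform A _](_ : _ = e / 4 - k / 2); last by rewrite vE (qform_unit Ay) // -vE.
have := fk x Ox; lra.
Unshelve. all: by end_near. Qed.

End Cones.

(** * The Perron function of the Dirichlet problem *)

Section PerronSolution.
Variables (R : realType) (n : nat) (n0 : (0 < n)%N) (Omega : set 'rV[R]_n).
Variables (f g : 'rV[R]_n -> R).
Hypotheses (Omega_bounded : bounded_set Omega) (Omega_open : open Omega).
Hypotheses (f_cont : {within Omega, continuous f}).
Hypotheses (f_bounded : [bounded f x | x in Omega]).
Hypotheses (g_cont : {within bdry Omega, continuous g}).
Implicit Types (u w : 'rV[R]_n -> R) (x y z : 'rV[R]_n) (a b k : R).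

Definition perron_class : set ('rV[R]_n -> R) := [set w |
  [/\ usc_on (closure Omega) w, visc_subsolution Omega f w &
      forall x, bdry Omega x -> w x <= g x]].

Definition perron x : R := sup [set w x | w in perron_class].

Lemma closure_bdry x : closure Omega x -> ~ Omega x -> bdry Omega x.
Proof. by move=> cx Ox; split=> //; rewrite ((interior_id _).1 Omega_open). Qed.

Lemma bdry_closure x : bdry Omega x -> closure Omega x /\ ~ Omega x.
Proof. by case=> cx; rewrite ((interior_id _).1 Omega_open). Qed.

Lemma perron_class_max w1 w2 : perron_class w1 -> perron_class w2 ->
  perron_class (fun x => Num.max (w1 x) (w2 x)).
Proof using n0.
move=> [u1 s1 g1] [u2 s2 g2]; split; first exact: usc_on_max.
  exact: visc_subsolution_max.
by move=> x bx; rewrite ge_max g1 // g2.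
Qed.

Lemma f_bound : exists2 k, 0 < k & forall x, Omega x -> `|f x| < k.
Proof.
case: f_bounded => M [_ hM]; have := hM (`|M| + 1).
rewrite (le_lt_trans (ler_norm M)) ?ltrDl // => /(_ isT) fM.
exists (`|M| + 2) => [|x /fM /=]; have := normr_ge0 M; lra.
Qed.

Lemma closure_bound : exists2 N, 0 <= N &
  forall x, closure Omega x -> enorm x <= N.
Proof.
case: Omega_bounded => M [_ hM]; have := hM (`|M| + 1).
rewrite (le_lt_trans (ler_norm M)) ?ltrDl // => /(_ isT) OM.
exists (n.+1%:R * (`|M| + 1)); first by rewrite mulr_ge0 // addr_ge0.
have OE : Omega `<=` eball 0 (n.+1%:R * (`|M| + 1)).
  move=> x /OM /= xM; rewrite /eball /= subr0.
  by apply: le_trans (enorm_le_norm x) _; rewrite ler_wpM2l.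
move=> x /(closure_subset OE).
by rewrite -((closure_id _).1 (@eball_closed _ _ _ _)) /eball /= subr0.
Qed.

Lemma closure_compact : compact (closure Omega).
Proof.
have [N N0 hN] := closure_bound.
apply: subclosed_compact (@closed_closure _ _) (@eball_compact _ _ 0 N) _.
by move=> x /hN; rewrite /eball /= subr0.
Qed.

Lemma g_bound : exists2 G, 0 <= G & forall x, bdry Omega x -> `|g x| <= G.
Proof.
have bc : compact (bdry Omega).
  apply: subclosed_compact closure_compact _; last by move=> x [].
  rewrite /bdry setDE; apply: closedI; first exact: closed_closure.
  by apply: open_closedC; exact: open_interior.
have [M [_ hM]] := compact_bounded (continuous_compact g_cont bc).
exists (`|M| + 1) => [|x bx]; first by rewrite addr_ge0.
by apply: hM; [rewrite (le_lt_trans (ler_norm M)) ?ltrDl|exists x].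
Qed.

(** The lower bound grows linearly with slope b - k D, so a cone
    with large slope exceeds any given value at distance d from its vertex. *)
Lemma cone_bounds a b k D z x : 0 < k -> enorm (x - z) <= D -> k * D <= b ->
  a + (b - k * D) * enorm (x - z) <= cone a b k z x <= a + b * enorm (x - z).
Proof.
rewrite /cone; have := enorm_ge0 (x - z); set s := enorm _ => s0 k0 sD kD.
have h1 : k * s * s <= k * D * s by rewrite ler_wpM2r // ler_pM2l.
have h2 : 0 <= k * s * s by rewrite !mulr_ge0 // ltW.
by apply/andP; split; rewrite expr2; lra.
Qed.

(** One choice of constants serves all cones: k dominates f, D dominates all
    distances, G dominates g, and z0 is a vertex away from Omega. *)
Definition problem_bounds k D G z0 := [/\ 0 < k /\ (forall x, Omega x -> `|f x| < k),
  0 < D /\ (forall x z, closure Omega x -> closure Omega z -> enorm (x - z) <= D),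
  0 <= G /\ (forall x, bdry Omega x -> `|g x| <= G) &
  ~ Omega z0 /\ (forall x, closure Omega x -> enorm (x - z0) <= D)].

Lemma problem_bounds_exist : exists k D G z0, problem_bounds k D G z0.
Proof.
have [k k0 hk] := f_bound; have [N N0 hN] := closure_bound.
have [G G0 hG] := g_bound; have [v v1] := exists_unit R n0.
have vN : enorm ((N + 1) *: v) = N + 1 by rewrite enormZ v1 mulr1 ger0_norm; lra.
exists k, (2 * N + 1), G, ((N + 1) *: v); split; split=> //.
- by lra.
- move=> x z /hN xN /hN zN; have := enormD x (- z); rewrite enormN; lra.
- by move=> /subset_closure/hN; rewrite vN; lra.
- move=> x /hN xN; have := enormD x (- ((N + 1) *: v)); rewrite enormN vN; lra.
Qed.

Section WithBounds.
Variables (k D G : R) (z0 : 'rV[R]_n).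
Hypothesis bounds : problem_bounds k D G z0.

Lemma upper_barrier a b z w x : ~ Omega z -> perron_class w ->
  (forall y, closure Omega y -> enorm (y - z) <= D) -> k * D < b ->
  (forall y, bdry Omega y -> g y <= cone a b k z y) ->
  closure Omega x -> w x <= cone a b k z x.
Proof.
case: bounds => -[k0 hk] [D0 _] _ _ Oz [uw sw gw] zD kD gc.
apply: (cone_comparison n0 sw uw closure_compact Omega_open) => //.
- exact: subset_closure.
- by apply: le_trans (ltW kD); rewrite mulr_ge0 // ltW.
- by move=> y /hk; exact: le_lt_trans (ler_norm _).
- move=> y /subset_closure/zD yD; apply: le_lt_trans kD.
  by rewrite ler_pM2l.
- by move=> y cy Oy; have by_ := closure_bdry cy Oy; apply: le_trans (gw _ by_) (gc _ by_).
Qed.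

Lemma lower_barrier a b z : ~ Omega z ->
  (forall y, closure Omega y -> enorm (y - z) <= D) -> k * D < b ->
  (forall y, bdry Omega y -> - cone a b k z y <= g y) ->
  perron_class (fun x => - cone a b k z x).
Proof.
case: bounds => -[k0 hk] [D0 _] _ _ Oz zD kD gc; split=> //.
  apply: usc_on_continuous; apply: continuous_subspaceT => x.
  exact: cvgN (@cone_continuous _ _ a b k z x).
apply: cone_subsolution => //.
- by apply: le_trans (ltW kD); rewrite mulr_ge0 // ltW.
- by move=> x /hk; rewrite ltr_norml; lra.
- move=> y /subset_closure/zD yD; apply: le_lt_trans kD.
  by rewrite ler_pM2l.
Qed.

(** The upper bound holds for all members, but a lower bound cannot; the
    fixed member bounded below repairs this after taking maxima with it. *)
Lemma perron_class_bounds : exists2 M, 0 <= M &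
  (forall w x, perron_class w -> closure Omega x -> w x <= M) /\
  exists2 w, perron_class w & forall x, closure Omega x -> - M <= w x.
Proof.
case: (bounds) => -[k0 hk] [D0 hD] [G0 hG] [Oz0 z0D].
pose b := k * D + 1; have kD : k * D < b by rewrite ltrDl.
have b0 : 0 < b by rewrite addr_gt0 // mulr_gt0.
have cb y : closure Omega y -> G <= cone G b k z0 y <= G + b * D.
  move=> /z0D yD; have /andP[h1 h2] := cone_bounds G k0 yD (ltW kD).
  have s0 := enorm_ge0 (y - z0).
  have : b * enorm (y - z0) <= b * D by rewrite ler_pM2l.
  have E : b - k * D = 1 by rewrite /b; ring.
  by move: h1; rewrite E; lra.
exists (G + b * D); first by rewrite addr_ge0 // mulr_ge0 // ltW.
split=> [w x Fw cx|].
  apply: le_trans (upper_barrier (a := G) (z := z0) (b := b) _ _ _ _ _ cx) _ => //.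
    move=> y by_; have [cy _] := bdry_closure by_.
    by have := hG y by_; have := cb y cy; rewrite ler_norml; lra.
  by have := cb x cx; lra.
exists (fun x => - cone G b k z0 x); last by move=> x /cb; lra.
apply: lower_barrier => // y by_; have [cy _] := bdry_closure by_.
by have := hG y by_; have := cb y cy; rewrite ler_norml; lra.
Qed.

Lemma perron_ge w x : perron_class w -> closure Omega x -> w x <= perron x.
Proof.
have [M M0 [hM _]] := perron_class_bounds => Fw cx; apply: ub_le_sup; last by exists w.
by exists M => _ [w' Fw' <-]; exact: hM.
Qed.

Lemma perron_approx x e : closure Omega x -> 0 < e ->
  exists2 w, perron_class w & perron x - e < w x.
Proof.
have [M M0 [hM [w0 Fw0 _]]] := perron_class_bounds => cx e0.
have [|_ [w Fw <-] h] := @sup_adherent _ [set w x | w in perron_class] e e0.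
  split; first by exists (w0 x), w0.
  by exists M => _ [w' Fw' <-]; exact: hM.
by exists w.
Qed.

Lemma perron_le x a : closure Omega x -> (forall w, perron_class w -> w x <= a) ->
  perron x <= a.
Proof.
move=> cx h; apply/ler_addgt0Pr => e e0.
have [w /h wa] := perron_approx cx e0; lra.
Qed.

(** In the ball of radius r around y, a member v bounded below by -M lies under
    the cone with vertex y and value v y there, because the slope L is chosen so
    that the cone gains at least 2 M between the vertex and the sphere.  Since L
    depends only on r, the estimate passes to the supremum. *)
Lemma perron_cone r : 0 < r -> exists2 L, 0 <= L & forall x y,
  eball y r `<=` Omega -> eball y r x -> perron x <= perron y + L * enorm (x - y).
Proof.
move=> r0; case: (bounds) => -[k0 hk] _ _ _.
have [M M0 [hM [w0 Fw0 w0M]]] := perron_class_bounds.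
pose L := 2 * M / r + k * r.
have L0 : 0 <= L by rewrite addr_ge0 // ?divr_ge0 ?mulr_ge0 // ltW.
have Lr : L * r = 2 * M + k * r ^+ 2 by rewrite /L; field; rewrite gt_eqF.
exists L => // x y yO xy.
have Oc := @subset_closure _ Omega.
have yy : eball y r y by rewrite /eball /= subrr enorm0 ltW.
apply: perron_le => [|w Fw]; first exact/Oc/yO.
pose v x := Num.max (w x) (w0 x); have Fv : perron_class v by exact: perron_class_max.
have [vu vs _] := Fv.
pose U : set 'rV[R]_n := [set x | 0 < enorm (x - y) < r].
have UK : U `<=` eball y r by move=> t /andP[_ /ltW].
have : v x <= cone (v y) L k y x.
  apply: (cone_comparison n0 vs _ (@eball_compact _ _ y r) (U := U)) xy => //.
  - by apply: usc_on_sub vu => t /yO /Oc.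
  - rewrite openE => t /andP[t0 tr]; apply/nbhs_enormP.
    exists (Num.min (enorm (t - y)) (r - enorm (t - y))).
      by rewrite lt_min t0 subr_gt0.
    move=> s; rewrite lt_min /U /= => /andP[s1 s2].
    have h1 := enormD (s - t) (t - y); have h2 := enormD (t - s) (s - y).
    by move: h1 h2; rewrite !addrA !subrK (enormB t s) => h1 h2; apply/andP; split; lra.
  - by move=> t /UK/yO.
  - by rewrite /U /= subrr enorm0 ltxx.
  - by move=> t /UK/yO/hk; exact: le_lt_trans (ler_norm _).
  - move=> t /andP[_ tr]; have : k * enorm (t - y) < k * r by rewrite ltr_pM2l.
    have : 0 <= 2 * M / r by rewrite divr_ge0 ?mulr_ge0 // ltW.
    by rewrite /L; lra.
  - move=> t Kt /negP; rewrite /U /= negb_and -!leNgt => /orP[|rt].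
      rewrite le_eqVlt ltNge enorm_ge0 orbF enorm_eq0 subr_eq0 => /eqP ->.
      by rewrite /cone subrr enorm0 expr0n /= !mulr0 subr0 addr0.
    have tr : enorm (t - y) = r by apply/eqP; rewrite eq_le Kt.
    have tM := hM v t Fv (Oc t (yO t Kt)).
    have : - M <= v y by rewrite le_max w0M ?orbT //; exact/Oc/yO.
    have : 0 <= k * r ^+ 2 by rewrite mulr_ge0 ?sqr_ge0 // ltW.
    by rewrite /cone tr Lr; lra.
have vy : v y <= perron y by apply: perron_ge => //; exact/Oc/yO.
have : w x <= v x by rewrite le_max lexx.
have : 0 <= k / 2 * enorm (x - y) ^+ 2.
  by rewrite mulr_ge0 ?sqr_ge0 // divr_ge0 // ltW.
by rewrite /cone; lra.
Qed.

Lemma perron_lipschitz x0 : Omega x0 -> exists r, exists2 L, 0 < r /\ 0 <= L &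
  eball x0 r `<=` Omega /\ forall x y, eball x0 r x -> eball x0 r y ->
    `|perron x - perron y| <= L * enorm (x - y).
Proof.
move=> Ox0; have [r r0 rO] := open_eball Omega_open Ox0.
have r20 : 0 < r / 2 by rewrite divr_gt0.
have [L L0 hL] := perron_cone r20.
have key x y : eball x0 (r / 4) x -> eball x0 (r / 4) y ->
    perron x <= perron y + L * enorm (x - y).
  rewrite /eball /= => xr yr; apply: hL.
    move=> t /= ty; apply: rO; have := enormD (t - y) (y - x0).
    by rewrite addrA subrK /eball /=; move: ty; rewrite /eball /=; lra.
  have := enormD (x - x0) (x0 - y); rewrite addrA subrK (enormB x0 y) /eball /=; lra.
exists (r / 4), L; split; first by rewrite divr_gt0.
- by [].
- by move=> t; rewrite /eball /= => tr; apply: rO; rewrite /eball /=; lra.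
- move=> x y xr yr; have := key x y xr yr; have := key y x yr xr.
  by rewrite (enormB y x) ler_norml; lra.
Qed.

(** Barriers with vertex z and value g z +- e / 2 there: near z the continuity of
    g keeps g between them, and farther than d from z the slope b makes
    them pass the bounds of g. *)
Lemma perron_bdry z e : bdry Omega z -> 0 < e ->
  exists2 r, 0 < r & forall x, closure Omega x -> enorm (x - z) < r ->
    `|perron x - g z| < e.
Proof.
move=> bz e0; case: (bounds) => -[k0 hk] [D0 hD] [G0 hG] _.
have [cz Oz] := bdry_closure bz.
have [d d0 hd] := (continuous_onP _ _).1 g_cont z bz (e / 2) (divr_gt0 e0 (ltr0n _ 2)).
(* The cone then gains at least 2 G over the distance d. *)
pose b := k * D + 2 * G / d + 1.
have kD0 : 0 < k * D by rewrite mulr_gt0.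
have Gd : 0 <= 2 * G / d by rewrite divr_ge0 ?mulr_ge0 // ltW.
have kD : k * D < b by rewrite /b; lra.
have b0 : 0 < b by lra.
have zD y : closure Omega y -> enorm (y - z) <= D by move=> cy; exact: hD.
have far y a : closure Omega y -> d <= enorm (y - z) -> a + 2 * G <= cone a b k z y.
  move=> cy dy; have /andP[h _] := cone_bounds a k0 (zD y cy) (ltW kD).
  apply: le_trans h; rewrite lerD2l.
  have -> : b - k * D = 2 * G / d + 1 by rewrite /b; ring.
  have : 2 * G / d * d <= 2 * G / d * enorm (y - z) by rewrite ler_wpM2l.
  by rewrite divfK ?gt_eqF // mulrDl mul1r; have := enorm_ge0 (y - z); lra.
have near_ y a : closure Omega y -> a <= cone a b k z y <= a + b * enorm (y - z).
  move=> cy; have /andP[h ->] := cone_bounds a k0 (zD y cy) (ltW kD).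
  rewrite andbT; apply: le_trans h; rewrite lerDl mulr_ge0 ?enorm_ge0 //.
  by rewrite subr_ge0 ltW.
have gz := hG z bz; rewrite ler_norml in gz.
exists (e / 2 / b); first by rewrite !divr_gt0.
move=> x cx; rewrite ltr_pdivlMr // mulrC => xz.
have up : perron x <= cone (g z + e / 2) b k z x.
  apply: perron_le => // w Fw; apply: upper_barrier => // y by_.
  have [cy _] := bdry_closure by_; have gy := hG y by_; rewrite ler_norml in gy.
  have [yd|yd] := ltP (enorm (y - z)) d.
    have := hd y by_ yd; have := near_ y (g z + e / 2) cy; rewrite ltr_norml; lra.
  by have := far y (g z + e / 2) cy yd; lra.
have lo : - cone (- g z + e / 2) b k z x <= perron x.
  apply: (perron_ge (w := fun x => - cone (- g z + e / 2) b k z x)) => //.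
  apply: lower_barrier => // y by_.
  have [cy _] := bdry_closure by_; have gy := hG y by_; rewrite ler_norml in gy.
  have [yd|yd] := ltP (enorm (y - z)) d.
    have := hd y by_ yd; have := near_ y (- g z + e / 2) cy; rewrite ltr_norml; lra.
  by have := far y (- g z + e / 2) cy yd; lra.
have := near_ x (g z + e / 2) cx; have := near_ x (- g z + e / 2) cx.
by rewrite ltr_norml; lra.
Qed.

Lemma perron_bdryE z : bdry Omega z -> perron z = g z.
Proof.
move=> bz; apply/eqP; rewrite -subr_eq0 -normr_le0; apply/ler_addgt0Pr => e e0.
have [r r0 h] := perron_bdry bz e0; rewrite add0r ltW //; apply: h; first by case: bz.
by rewrite subrr enorm0.
Qed.

Lemma perron_continuous : {within closure Omega, continuous perron}.
Proof.
apply/continuous_onP => x cx e e0; have [Ox|Ox] := pselect (Omega x); last first.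
  by have bx := closure_bdry cx Ox; rewrite (perron_bdryE bx); exact: perron_bdry.
have [r [L [r0 L0] [rO hL]]] := perron_lipschitz Ox.
exists (Num.min r (e / (L + 1))); first by rewrite lt_min r0 divr_gt0 // ltr_wpDl.
move=> y cy; rewrite lt_min ltr_pdivlMr ?ltr_wpDl // => /andP[yr ye].
apply: le_lt_trans (hL y x (ltW yr) _) _; first by rewrite /eball /= subrr enorm0 ltW.
by have := enorm_ge0 (y - x); lra.
Qed.

Lemma perron_locally_lipschitz : locally_lipschitz Omega perron.
Proof.
move=> x Ox; have [r [L [r0 L0] [rO hL]]] := perron_lipschitz Ox.
exists (eball x r); first by apply/nbhs_enormP; exists r => // y /ltW.
have xx : ((eball x r `&` Omega) `*` (eball x r `&` Omega)) (x, x).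
  by rewrite /= /eball /= subrr enorm0 ltW.
have FF := globally_properfilter xx.
apply: (@klipschitzW _ _ _ (L * n.+1%:R)) => -[y1 y2] /= [[h1 _] [h2 _]].
apply: le_trans (hL _ _ h1 h2) _; rewrite -mulrA ler_wpM2l //.
exact: enorm_le_norm.
Qed.

Lemma perron_solution : dirichlet_solution Omega f g perron.
Proof.
have cu := perron_continuous; have Oc := @subset_closure _ Omega.
have uu := usc_on_continuous cu.
have sub : visc_subsolution Omega f perron.
  apply: (visc_subsolution_sup n0 (F := perron_class)) => //.
  - exact: usc_on_sub Oc uu.
  - by move=> w [].
  - by move=> w x Fw /Oc; exact: perron_ge.
  - by move=> x e /Oc; exact: perron_approx.
split=> //; [exact: perron_locally_lipschitz| |exact: perron_bdryE].
split=> //; apply: (visc_supersolution_maximal n0 (g := g)) => //.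
- apply: usc_on_sub Oc _; apply: usc_on_continuous => x.
  exact: cvgN (cu x).
- by move=> x /perron_bdryE ->.
- by move=> w uw sw gw x /Oc; apply: perron_ge; split.
Qed.

End WithBounds.
End PerronSolution.

Lemma maximal_dirichlet_solution (R : realType) (n : nat) (n0 : (0 < n)%N)
    (Omega : set 'rV[R]_n) (f g : 'rV[R]_n -> R) :
  bounded_set Omega -> open Omega -> {within Omega, continuous f} ->
  [bounded f x | x in Omega] -> {within bdry Omega, continuous g} ->
  exists2 u, dirichlet_solution Omega f g u & forall w,
    usc_on (closure Omega) w -> visc_subsolution Omega f w ->
    (forall x, bdry Omega x -> w x <= g x) -> forall x, Omega x -> w x <= u x.
Proof.
move=> bO oO cf bf cg.
have [k [D [G [z0 bounds]]]] := problem_bounds_exist n0 bO bf cg.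
exists (perron Omega f g); first exact: (perron_solution n0 _ _ _ _ bounds).
move=> w uw sw gw x Ox; apply: (perron_ge n0 _ _ bounds) => //.
exact: subset_closure.
Qed.

(** * Both extremal solutions *)

Lemma dirichlet_solution_opp (R : realType) (n : nat)
    (Omega : set 'rV[R]_n) (f g u : 'rV[R]_n -> R) :
  dirichlet_solution Omega (fun x => - f x) (fun x => - g x) u ->
  dirichlet_solution Omega f g (fun x => - u x).
Proof.
case=> cu lu [su Su] ug; split.
- by move=> x; apply: (@continuousN _ _ _ (u : subspace _ -> R)); exact: cu.
- move=> x Ox; have [U nU hU] := lu x Ox; exists U => //.
  move: hU; rewrite /lipschitz_on; apply: filterS => M h xy hxy /=.
  by rewrite -opprD normrN; exact: h.
- split.
    have fE : (fun x => - - f x) = f by apply/funext => x; rewrite opprK.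
    by move/visc_supersolutionE: Su; rewrite fE.
  apply/visc_supersolutionE.
  by have -> : (fun x => - - u x) = u by apply/funext => x; rewrite opprK.
- by move=> x bx; rewrite ug ?opprK.
Qed.

Theorem theorem2p14 (R : realType) (n : nat) (hn : (0 < n)%N)
    (Omega : set 'rV[R]_n)
    (Omega_bounded : bounded_set Omega)
    (Omega_connected : connected Omega)
    (Omega_open : open Omega)
    (Omega_diam : (path_diam Omega < +oo)%E)
    (f g : 'rV[R]_n -> R)
    (f_cont : {within Omega, continuous f})
    (f_bounded : [bounded f x | x in Omega])
    (g_cont : {within bdry Omega, continuous g}) :
  exists u_min u_max : 'rV[R]_n -> R,
    [/\ dirichlet_solution Omega f g u_min,
        dirichlet_solution Omega f g u_max,
        (forall w : 'rV[R]_n -> R,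
           usc_on (closure Omega) w ->
           visc_subsolution Omega f w ->
           (forall x, bdry Omega x -> w x <= g x) ->
           forall x, Omega x -> w x <= u_max x) &
        (forall w : 'rV[R]_n -> R,
           lsc_on (closure Omega) w ->
           visc_supersolution Omega f w ->
           (forall x, bdry Omega x -> g x <= w x) ->
           forall x, Omega x -> u_min x <= w x)].
Proof.
have [u su umax] := maximal_dirichlet_solution hn Omega_bounded Omega_open f_cont f_bounded g_cont.
have [|||v sv vmax] := @maximal_dirichlet_solution R n hn Omega (fun x => - f x) (fun x => - g x)
  Omega_bounded Omega_open.
- by move=> x; apply: (@continuousN _ _ _ (f : subspace _ -> R)); exact: f_cont.
- case: f_bounded => M [Mr hM]; exists M; split=> // N /hM h x /h /=.
  by rewrite normrN.
- by move=> x; apply: (@continuousN _ _ _ (g : subspace _ -> R)); exact: g_cont.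
exists (fun x => - v x), u; split=> //; first exact: dirichlet_solution_opp.
move=> w lw Sw gw x Ox; rewrite lerNl; apply: (vmax (fun x => - w x)) => //.
- by rewrite /usc_on; have -> : (fun x => - - w x) = w by apply/funext => t; rewrite opprK.
- exact/visc_supersolutionE.
- by move=> t bt; rewrite lerN2; exact: gw.
Qed.
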